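(* For any integers $3\le a\le b\le c\le d$, there exists a connected graph $G$ satisfying $g(G)=a$, $eg(G)=b$, $seg(G)=c$ and $meg(G)=d$.
   Context: All graphs are finite, simple, undirected and connected. Let $G$ be such a graph with vertex set $V(G)$ and edge set $E(G)$. - A geodetic set of $G$ is a set $S\subseteq V(G)$ such that every vertex of $G$ lies on some (at least one) shortest path between some pair of distinct vertices of $S$. The geodetic number $g(G)$ is the minimum cardinality of a geodetic set. - An edge-geodetic set of $G$ is a set $S\subseteq V(G)$ such that every edge of $G$ lies on some (at least one) shortest path between some pair of distinct vertices of $S$. The edge-geodetic number $eg(G)$ is the minimum cardinality of an edge-geodetic set. - A strong edge-geodetic set of $G$ is a set $S\subseteq V(G)$ for which one can choose, for each unordered pair of distinct vertices $u,v\in S$, one specific shortest $u$--$v$ path $P_{uv}$, such that every edge of $G$ lies on at least one of the chosen paths. The strong edge-geodetic number $seg(G)$ is the minimum cardinality of a strong edge-geodetic set. - A monitoring edge-geodetic set (MEG-set) of $G$ is a set $S\subseteq V(G)$ such that for every edge $e\in E(G)$ there is a pair of distinct vertices $u,v\in S$ such that $e$ lies on every shortest $u$--$v$ path in $G$. The monitoring edge-geodetic number $meg(G)$ is the minimum cardinality of an MEG-set. *)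

(* Defs.v *)
From mathcomp Require Import all_boot.

Set Implicit Arguments.
Unset Strict Implicit.
Unset Printing Implicit Defensive.

Record sgraph := SGraph {
  vertex :> finType;
  adj : rel vertex;
  adj_sym : symmetric adj;
  adj_irrefl : irreflexive adj
}.

Definition connected_graph (G : sgraph) : Prop :=
  0 < #|G| /\ forall x y : G, connect (@adj G) x y.

Section Geodesics.

Variable G : sgraph.
Implicit Types (x y u v : G) (s : seq G) (S : {set G}).

(* A path is the sequence of all its vertices, both ends included; its length
   is therefore (size s).-1. *)
Definition path_between u v s : bool :=
  if s is z :: p then
    [&& z == u, last z p == v, path (@adj G) z p & uniq (z :: p)]
  else false.

Definition shortest_path u v s : Prop :=
  path_between u v s /\ forall t, path_between u v t -> size s <= size t.

(* zip s (behead s) lists the pairs of consecutive vertices of s; the edge xy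
   may be traversed in either direction. *)
Definition edge_on x y s : bool :=
  ((x, y) \in zip s (behead s)) || ((y, x) \in zip s (behead s)).

Definition geodetic_set S : Prop :=
  forall x, exists u v s,
    [/\ u \in S, v \in S, u != v, shortest_path u v s & x \in s].

Definition edge_geodetic_set S : Prop :=
  forall x y, adj x y -> exists u v s,
    [/\ u \in S, v \in S, u != v, shortest_path u v s & edge_on x y s].

(* P is indexed by the unordered pair [set u; v], so only one path is chosen for
   the two orderings of u and v; it may be listed from either end. *)
Definition strong_edge_geodetic_set S : Prop :=
  exists P : {set G} -> seq G,
    (forall u v, u \in S -> v \in S -> u != v ->
       shortest_path u v (P [set u; v]) \/ shortest_path v u (P [set u; v])) /\
    (forall x y, adj x y -> exists u v,
       [/\ u \in S, v \in S, u != v & edge_on x y (P [set u; v])]).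

Definition meg_set S : Prop :=
  forall x y, adj x y -> exists u v,
    [/\ u \in S, v \in S, u != v &
        forall s, shortest_path u v s -> edge_on x y s].

Definition min_card (Q : {set G} -> Prop) (k : nat) : Prop :=
  (exists S, Q S /\ #|S| = k) /\ (forall S, Q S -> k <= #|S|).

End Geodesics.

(* These parameters are rendered as relations because a geodetic set need not
   exist: an isolated vertex lies on no path between distinct vertices. *)
Definition geodetic_number (G : sgraph) : nat -> Prop :=
  min_card (@geodetic_set G).

Definition edge_geodetic_number (G : sgraph) : nat -> Prop :=
  min_card (@edge_geodetic_set G).

Definition strong_edge_geodetic_number (G : sgraph) : nat -> Prop :=
  min_card (@strong_edge_geodetic_set G).

Definition meg_number (G : sgraph) : nat -> Prop :=
  min_card (@meg_set G).

(* Main.v *)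
Require Import Defs.
From HB Require Import structures.
From mathcomp Require Import all_boot zify.

Set Implicit Arguments.
Unset Strict Implicit.
Unset Printing Implicit Defensive.

(** A single family of graphs [core] realises all quadruples; its edges are, with
    heights growing upwards,

<<
              Leaf i      Apex
                  \     /  |   \
                    Hub--Side i  Spoke j
                     |   /         |
                   Mid t0       Mid (mu j)
                        \       /
                         Joint n
                         /     \
               Twin false       Twin true
                         \     /
                           ...
                         Joint 0
                            |
                           Tail
>>

    where Hub, all sides and all spokes are joined to Apex.  There are q + 1
    leaves, m sides, k + 1 spokes and n squares in the chain from Tail to the last joint.  Except for
    the edges Hub -- Side i, every edge raises the height by one, so every
    ascending path is a geodesic ([climb_shortest]).

    - Geodetic sets.  Tail and the leaves have degree one and are forced
      ([geodetic_leaf]); they do not cover the spokes.  Adding Apex is enough,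
      because every vertex is on an ascending path from Tail to Apex or to a leaf.
      Hence g = q + 3.
    - Edge-geodetic sets.  All neighbours of Side i are Hub or neighbours of Hub,
      so no geodesic crosses the edge Hub -- Side i and then leaves Side i:
      each side is forced ([eg_forced]).  With the sides added, everything is
      covered, and eg = g + m.
    - Strong edge-geodetic sets.  A geodesic crossing Spoke j without ending near
      it must join Apex to a vertex w of the chain, or to the middle vertex when
      all of them are merged into one ([spoke_ends]).  A pair
      {w, Apex} has only one path to spend, and that path crosses a single spoke.
      So each spoke costs its own vertex: itself, the middle vertex under it, or a
      w; and one more vertex is always there, Apex if some w is used and Tail
      otherwise.  This gives seg = q + m + k + 3 ([strong_lower]).  The chain costs
      nothing, since the paths from Tail to a leaf and from Tail to a spoke can
      follow opposite sides of all squares.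
    - Monitoring sets.  The two twins of a square can be exchanged in any geodesic
      that crosses it, which forces both ([meg_forced]), so the chain adds 2n.
      The middle vertices decide the parity.  If they are pairwise distinct,
      then Spoke j -- Apex -- Hub -- Leaf i is the only geodesic between its ends,
      so the spokes, the sides and the leaves monitor the edges at Apex and
      meg = seg + 2n.  If all of them are merged into one, it has the same upper
      neighbours as Apex has lower ones; then the two can be exchanged, Apex is
      forced ([meg_apex]), and meg = seg + 2n + 1.

    All lower bounds come from injections into the set; the upper bounds use the
    image of a map of the same shape ([min_card_le]). *)

(** * Geodesics as shortest walks *)

Section GeodesicCalculus.

Variable G : sgraph.
Implicit Types (u v x y : G) (s : seq G) (S : {set G}).

Definition walk u v s : bool :=
  if s is z :: p then [&& z == u, last z p == v & path (@adj G) z p] else false.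

(** Erasing the loops of a walk only shortens it, so minimality can be tested
    against all walks, and a minimal walk is automatically free of repetitions.
    Paths can thus be cut and pasted without any care for uniqueness. *)
Lemma shortest_walkP u v s :
  shortest_path u v s <->
  walk u v s /\ forall t, walk u v t -> size s <= size t.
Proof.
split=> [[] | [ws smin]].
  case: s => [//|z p] /and4P[zu lv zp _] smin; split; first exact/and3P.
  case=> [//|a t] /and3P[/eqP au /eqP lt at_].
  case: (shortenP at_) lt => t' pt' ut' st' lt.
  have /smin szt : path_between u v (a :: t').
    by rewrite /path_between au eqxx -au lt eqxx pt'.
  apply: leq_trans szt _; rewrite ltnS uniq_leq_size //; first by case/andP: ut'.
have bet t : path_between u v t -> walk u v t.
  by case: t => [//|z p] /and4P[zu lv zp _]; apply/and3P.
split; last by move=> t /bet/smin.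
case: s ws smin => [//|z p] /and3P[zu /eqP lv zp] smin.
apply/and4P; split=> //; first exact/eqP.
case: (shortenP zp) lv => p' pp' up' sp' lv.
have /smin szp : walk u v (z :: p') by rewrite /walk zu lv eqxx pp'.
apply: leq_size_uniq up' _ szp.
by move=> w; rewrite !inE => /orP[->//|/sp' /= ->]; rewrite orbT.
Qed.

Lemma walk_rev u v s : walk u v s -> walk v u (rev s).
Proof.
case: s => [//|z p] /and3P[/eqP<- /eqP lp zp].
have -> : rev (z :: p) = v :: rev (belast z p).
  by rewrite lastI lp rev_rcons.
rewrite /walk eqxx -lp /= rev_path; apply/andP; split; last first.
  by rewrite (eq_path (e' := @adj G)) // => a b; rewrite adj_sym.
by case: p {zp lp} => [|a p] /=; rewrite ?eqxx // rev_cons last_rcons.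
Qed.

Lemma shortest_rev u v s : shortest_path u v s -> shortest_path v u (rev s).
Proof.
move/shortest_walkP=> [ws smin]; apply/shortest_walkP; split.
  exact: walk_rev.
by move=> t /walk_rev/smin; rewrite !size_rev.
Qed.

Lemma shortest_uniq u v s : shortest_path u v s -> uniq s.
Proof. by case; case: s => [//|z p] /and4P[]. Qed.

Lemma edge_onP x y s :
  reflect (exists s1 s2, s = s1 ++ x :: y :: s2 \/ s = s1 ++ y :: x :: s2)
          (edge_on x y s).
Proof.
have zipP a b : reflect (exists s1 s2, s = s1 ++ a :: b :: s2)
                        ((a, b) \in zip s (behead s)).
  elim: s => [|c [|d s] IH] /=; try by right=> -[[|?[|? ?]] [?]].
  rewrite inE; apply: (iffP orP) => [[/eqP[-> ->]|/IH[s1 [s2 ->]]]|].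
  - by exists [::], s.
  - by exists (c :: s1), s2.
  - case=> [[|c' s1] [s2 /= [-> e]]]; first by rewrite e eqxx; left.
    by right; apply/IH; exists s1, s2.
apply: (iffP orP) => [[/zipP[s1 [s2 ->]]|/zipP[s1 [s2 ->]]]|].
- by exists s1, s2; left.
- by exists s1, s2; right.
- by case=> s1 [s2 [e|e]]; [left|right]; apply/zipP; exists s1, s2.
Qed.

Lemma edge_onC x y s : edge_on x y s = edge_on y x s.
Proof. by rewrite /edge_on orbC. Qed.

Lemma edge_on_rev x y s : edge_on x y (rev s) = edge_on x y s.
Proof.
have imp t : edge_on x y t -> edge_on x y (rev t).
  move=> /edge_onP[s1 [s2 [->|->]]]; apply/edge_onP; exists (rev s2), (rev s1);
    [right|left]; by rewrite rev_cat !rev_cons !cat_rcons.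
by apply/idP/idP => /imp; rewrite ?revK.
Qed.

Lemma edge_on_mem x y s : edge_on x y s -> x \in s /\ y \in s.
Proof.
by move=> /edge_onP[s1 [s2 [->|->]]]; rewrite !mem_cat !inE !eqxx !orbT.
Qed.

Lemma edge_on_cat x y s t :
  edge_on x y s -> edge_on x y (s ++ t).
Proof.
move=> /edge_onP[s1 [s2 [->|->]]]; apply/edge_onP; exists s1, (s2 ++ t);
  by rewrite -catA /=; auto.
Qed.

Lemma edge_on_join u y p t :
  edge_on (last u p) y ((u :: p) ++ y :: t).
Proof.
apply/edge_onP; case/lastP: p => [|p x]; first by exists [::], t; left.
by exists (u :: p), t; left; rewrite last_rcons /= cat_rcons.
Qed.

(** Reversing the path if needed, an edge may be assumed to be crossed in a
    prescribed direction. *)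
Lemma orient_edge u v s x y : shortest_path u v s -> edge_on x y s ->
  exists u' v' s1 s2, ((u' = u /\ v' = v) \/ (u' = v /\ v' = u)) /\
    shortest_path u' v' (s1 ++ x :: y :: s2).
Proof.
move=> ss /edge_onP[s1 [s2 [e|e]]].
  by exists u, v, s1, s2; split; [left | rewrite -e].
have e' : rev s2 ++ x :: y :: rev s1 = rev s.
  by rewrite e rev_cat !rev_cons !cat_rcons.
exists v, u, (rev s2), (rev s1); split; first by right.
by rewrite e'; apply: shortest_rev.
Qed.

Lemma shortest_first u v x s : shortest_path u v (x :: s) -> x = u.
Proof. by case=> /and4P[/eqP ->]. Qed.

Lemma shortest_last u v s x : shortest_path u v (rcons s x) -> x = v.
Proof.
by move=> /shortest_rev; rewrite rev_rcons => /shortest_first.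
Qed.

Lemma shortest_adj u v s1 x y s2 :
  shortest_path u v (s1 ++ x :: y :: s2) -> adj x y.
Proof.
case; case: s1 => [|z s1] /= /and4P[_ _ + _] _; first by case/andP.
by rewrite cat_path /= => /and4P[].
Qed.

(** A path reaches its end through a single edge; this is what limits one chosen
    path to a single spoke. *)
Lemma last_edge u v x y s : shortest_path u v s ->
  edge_on x v s -> edge_on y v s -> x = y.
Proof.
move=> /shortest_rev ss; rewrite -!(edge_on_rev _ _ s).
have := shortest_uniq ss; case: (rev s) ss => [[]//|z p] /shortest_first->.
case/andP=> vp _.
have next w : edge_on w v (v :: p) -> exists p', p = w :: p'.
  case/edge_onP=> -[|z' s1] [s2 [] /(congr1 behead) /= ep].
  - by rewrite ep inE eqxx in vp.
  - by exists s2.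
  - by rewrite ep mem_cat !inE eqxx !orbT in vp.
  - by rewrite ep mem_cat !inE eqxx !orbT in vp.
by move=> /next[p1 ep1] /next[p2]; rewrite ep1 => -[].
Qed.

Lemma edge_on_inner u v x y z s : shortest_path u v s ->
  x \in s -> x != u -> x != v -> (forall w, adj x w -> w = y \/ w = z) ->
  edge_on x z s.
Proof.
move=> ss xs nu nv nx; case/splitPr: xs ss => s1 s2 ss.
case: (lastP s1) ss => [|s1' a] ss; first by rewrite (shortest_first ss) eqxx in nu.
case: s2 ss => [|b s2] ss.
  by move: ss; rewrite cats1 => /shortest_last e; rewrite e eqxx in nv.
have [eb|eb] := nx b (shortest_adj ss); last first.
  by apply/edge_onP; exists (rcons s1' a), s2; left; rewrite eb.
have us := shortest_uniq ss; rewrite cat_rcons in us ss *.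
have := shortest_adj ss; rewrite adj_sym => /nx[] ea; last first.
  by apply/edge_onP; exists s1', (b :: s2); right; rewrite ea.
by move: us; rewrite ea eb cat_uniq /= !inE eqxx orbT !andbF.
Qed.

(** The three next lemmas replace a segment of a path; [shortest_sub] is the
    shortcut argument, [shortest_splice] the exchange argument. *)
Lemma walk_splice u v s1 x p s2 q : walk u v (s1 ++ x :: p ++ s2) ->
  path (@adj G) x q -> last x q = last x p -> walk u v (s1 ++ x :: q ++ s2).
Proof.
move=> + pq lq; case: s1 => [|z s1] /=.
  by rewrite /walk !cat_path !last_cat lq pq => /and4P[-> -> _ ->].
rewrite !cat_path !last_cat /= !cat_path !last_cat lq pq.
by case/and3P=> -> -> /and4P[-> -> _ ->].
Qed.

Lemma shortest_sub u v s1 x p s2 q : shortest_path u v (s1 ++ x :: p ++ s2) ->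
  path (@adj G) x q -> last x q = last x p -> size p <= size q.
Proof.
move=> /shortest_walkP[ws smin] pq lq.
have := smin _ (walk_splice ws pq lq).
by rewrite !size_cat /= !size_cat leq_add2l ltnS leq_add2r.
Qed.

Lemma shortest_splice u v s1 x p s2 q :
  shortest_path u v (s1 ++ x :: p ++ s2) -> path (@adj G) x q ->
  last x q = last x p -> size q = size p ->
  shortest_path u v (s1 ++ x :: q ++ s2).
Proof.
move=> /shortest_walkP[ws smin] pq lq szq; apply/shortest_walkP; split.
  exact: walk_splice ws pq lq.
by move=> t /smin; rewrite !size_cat /= !size_cat szq.
Qed.

Lemma shortest_exists u v : connect (@adj G) u v -> exists s, shortest_path u v s.
Proof.
case/connectP=> p up lp.
have ex : exists n, [exists t : n.-tuple G, walk u v t].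
  exists (size p).+1; apply/existsP; exists (in_tuple (u :: p)).
  by rewrite /= eqxx -lp eqxx up.
case: (ex_minnP ex) => n /existsP[t wt] tmin.
exists t; apply/shortest_walkP; split=> // t' wt'.
rewrite size_tuple; apply: tmin; apply/existsP; by exists (in_tuple t').
Qed.

Lemma shortest2 u x v : u != v -> ~~ adj u v -> adj u x -> adj x v ->
  shortest_path u v [:: u; x; v].
Proof.
move=> nuv nadj ux xv; apply/shortest_walkP; split.
  by rewrite /walk /= !eqxx ux xv.
case=> [//|z [|w [|? ?]]] //= /and3P[/eqP->].
  by rewrite (negPf nuv).
by move=> /eqP->; rewrite (negPf nadj).
Qed.

(** With a single common neighbour, two vertices at distance two monitor both
    edges at that neighbour. *)
Lemma shortest2_edges u x v s : u != v -> ~~ adj u v -> adj u x -> adj x v ->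
  (forall y, adj u y -> adj y v -> y = x) ->
  shortest_path u v s -> edge_on u x s /\ edge_on x v s.
Proof.
move=> nuv nadj ux xv uniqx /shortest_walkP[ws smin].
have : size s <= 3.
  by apply: (smin [:: u; x; v]); rewrite /walk /= !eqxx ux xv.
case: s ws {smin} => [//|z [|w [|y [|? ?]]]] //= /and3P[/eqP->].
- by rewrite (negPf nuv).
- by move=> /eqP->; rewrite (negPf nadj).
- move=> /eqP-> /and3P[uw wv _] _; rewrite -(uniqx _ uw wv).
  by rewrite /edge_on /= !inE !eqxx !orbT.
Qed.

Lemma shortest1_edge u v s : adj u v -> shortest_path u v s -> edge_on u v s.
Proof.
move=> uv /shortest_walkP[ws smin].
have : size s <= 2 by apply: (smin [:: u; v]); rewrite /walk /= !eqxx uv.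
case: s ws {smin} => [//|z [|w [|? ?]]] //= /and3P[/eqP->].
  by move=> /eqP e; rewrite e adj_irrefl in uv.
by move=> /eqP-> _ _; rewrite /edge_on /= !inE eqxx.
Qed.

(** * Forced vertices *)

(** A geodesic crossing from [x] to [v] and continuing to [y] could go directly
    from [x] to [y]; so it has to stop at [v]. *)
Lemma eg_forced S v x : adj x v ->
  (forall y, adj v y -> y != x -> adj x y) ->
  edge_geodetic_set S -> v \in S.
Proof.
move=> xv nv /(_ _ _ xv)[u [w [s [uS wS nuw ss es]]]].
have [u' [w' [s1 [s2 [uw' ss']]]]] := orient_edge ss es.
case: s2 ss' => [|y s2] ss'.
  have e : v = w'.
    by move: ss'; rewrite -cat_rcons cats1 => /shortest_last.
  by rewrite e; case: uw' => -[_ ->].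
have vy : adj v y.
  by move: ss'; rewrite -cat_rcons => /shortest_adj.
have nyx : y != x.
  move/shortest_uniq: ss'; rewrite cat_uniq /= !inE !negb_or.
  by case/and3P=> _ _ /andP[/and3P[_ + _] _]; rewrite eq_sym.
have pq : path (@adj G) x [:: y] by rewrite /= nv.
by have := shortest_sub (p := [:: v; y]) ss' pq erefl.
Qed.

Hypothesis Gconn : connected_graph G.

(** If the geodesic continues from [v] to [y], then it can be rerouted through [z]
    so as to avoid [v]; hence the edge is not monitored unless [v] is an end. *)
Lemma meg_forced S v x : adj x v ->
  (forall y, adj v y -> y != x ->
     adj x y \/ exists z, [/\ z != v, adj x z & adj z y]) ->
  meg_set S -> v \in S.
Proof.
move=> xv nv /(_ _ _ xv)[u [w [uS wS nuw mon]]].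
have [s ss] := shortest_exists (Gconn.2 u w).
have [u' [w' [s1 [s2 [uw' ss']]]]] := orient_edge ss (mon _ ss).
case: s2 ss' => [|y s2] ss'.
  have e : v = w'.
    by move: ss'; rewrite -cat_rcons cats1 => /shortest_last.
  by rewrite e; case: uw' => -[_ ->].
have vy : adj v y.
  by move: ss'; rewrite -cat_rcons => /shortest_adj.
have := shortest_uniq ss'; rewrite cat_uniq /= !inE !negb_or.
case/and5P=> _ /and4P[_ nv1 _ _] /and3P[_ nxy _] /andP[nvy nv2] _.
have nyx : y != x by rewrite eq_sym.
have [xy|[z [nzv xz zy]]] := nv y vy nyx.
  have pq : path (@adj G) x [:: y] by rewrite /= xy.
  by have := shortest_sub (p := [:: v; y]) ss' pq erefl.
have pq : path (@adj G) x [:: z; y] by rewrite /= xz zy.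
have /= ss2 := shortest_splice (p := [:: v; y]) ss' pq erefl erefl.
have : edge_on x v (s1 ++ x :: z :: y :: s2).
  case: uw' => -[eu ew]; rewrite eu ew in ss2; first exact: mon.
  by rewrite -edge_on_rev; apply: mon; apply: shortest_rev.
have nvx : (v == x) = false.
  by apply/eqP => e; rewrite e adj_irrefl in xv.
move=> /edge_on_mem[_]; rewrite mem_cat !inE (negPf nv1) nvx.
by rewrite eq_sym (negPf nzv) (negPf nvy) (negPf nv2).
Qed.

(** An inner vertex of a path has two distinct neighbours. *)
Lemma geodetic_leaf S v x : (forall y, adj v y -> y = x) ->
  geodetic_set S -> v \in S.
Proof.
move=> nv /(_ v)[u [w [s [uS wS nuw ss vs]]]].
case/splitPr: vs ss => s1 s2 ss.
case: s2 ss => [|y s2] ss.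
  by move: ss; rewrite cats1 => /shortest_last ->.
case: (lastP s1) ss => [|s0 z] ss; first by rewrite (shortest_first ss).
have vy := shortest_adj ss.
rewrite cat_rcons in ss.
have zv := shortest_adj ss; rewrite adj_sym in zv.
move: (shortest_uniq ss); rewrite (nv _ vy) (nv _ zv) cat_uniq /= !inE eqxx.
by rewrite orbT /= !andbF.
Qed.

Lemma seg_eg S : strong_edge_geodetic_set S -> edge_geodetic_set S.
Proof.
move=> [P [Psh Pcov]] x y /Pcov[u [v [uS vS nuv e]]].
by case: (Psh u v uS vS nuv) => ss; [exists u, v | exists v, u];
  exists (P [set u; v]); split=> //; rewrite eq_sym.
Qed.

Lemma meg_eg S : meg_set S -> edge_geodetic_set S.
Proof.
move=> Sm x y /Sm[u [v [uS vS nuv mon]]].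
by have [s ss] := shortest_exists (Gconn.2 u v); exists u, v, s; split=> //; apply: mon.
Qed.

(** A strong edge-geodetic set asks for one path per unordered pair.  It suffices to
    choose paths for some ordered pairs, never for both orders of the same pair:
    the remaining pairs get an arbitrary geodesic. *)
Lemma strong_of_partial_choice S (P0 : G -> G -> option (seq G)) :
  (forall u v s, P0 u v = Some s -> shortest_path u v s /\ P0 v u = None) ->
  (forall x y, adj x y -> exists u v s,
     [/\ u \in S, v \in S, u != v, P0 u v = Some s & edge_on x y s]) ->
  strong_edge_geodetic_set S.
Proof.
move=> P0sh P0cov.
have [D Dsh] : exists D : G * G -> seq G, forall uv, shortest_path uv.1 uv.2 (D uv).
  apply: (@fin_all_exists _ (fun=> seq G) (fun uv => shortest_path uv.1 uv.2)).
  by move=> uv; apply: shortest_exists (Gconn.2 _ _).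
pose P1 u v := odflt (odflt (D (u, v)) (P0 v u)) (P0 u v).
pose P (A : {set G}) := if enum A is [:: u; v] then P1 u v else [::].
have PE u v : u != v -> P [set u; v] = P1 u v \/ P [set u; v] = P1 v u.
  move=> nuv; rewrite /P.
  (* [enum] lists the pair in an order fixed by the type of vertices. *)
  have : perm_eq (enum [set u; v]) [:: u; v].
    apply: uniq_perm; rewrite ?enum_uniq //= ?inE ?nuv //.
    by move=> z; rewrite mem_enum !inE.
  move=> pe; have := perm_size pe; have := perm_mem pe; have := enum_uniq [set u; v].
  case: (enum _) => [|z [|w [|? ?]]] //= nzw me _.
  have := me z; have := me w; rewrite !inE !eqxx !orbT.
  move: nzw; rewrite inE andbT.
  move=> nzw /esym/orP[/eqP ew|/eqP ew] /esym/orP[/eqP ez|/eqP ez];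
    rewrite ew ez ?eqxx // in nzw *; by [left | right].
exists P; split=> [u v uS vS nuv|x y /P0cov[u [v [s [uS vS nuv e es]]]]].
  have sh1 a b : shortest_path a b (P1 a b) \/ shortest_path b a (P1 a b).
    rewrite /P1; case e: (P0 a b) => [s|] /=; first by left; case: (P0sh _ _ _ e).
    case e': (P0 b a) => [s|] /=; first by right; case: (P0sh _ _ _ e').
    by left; apply: (Dsh (a, b)).
  by case: (PE u v nuv) => ->; case: (sh1 u v); case: (sh1 v u); auto.
exists u, v; split=> //.
have [_ e'] := P0sh _ _ _ e.
by case: (PE u v nuv) => ->; rewrite /P1 e ?e'.
Qed.

(** * Ascending paths of a height function *)

(** A function growing by at most one along each edge bounds distances from below,
    so a path along which it grows by one at each step is a geodesic. *)
Variable f : G -> nat.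
Hypothesis f_lip : forall x y, adj x y -> f y <= (f x).+1.

Definition climb : rel G := [rel x y | adj x y && (f y == (f x).+1)].

Lemma climb_height x p : path climb x p -> f (last x p) = f x + size p.
Proof.
elim: p x => [|y p IH] x /=; first by rewrite addn0.
by case/andP=> /andP[_ /eqP e] /IH ->; rewrite e addSnnS.
Qed.

Lemma path_height x p : path (@adj G) x p -> f (last x p) <= f x + size p.
Proof.
elim: p x => [|y p IH] x /=; first by rewrite addn0.
case/andP=> /f_lip e /IH h; apply: leq_trans h _.
by rewrite -addSnnS leq_add2r.
Qed.

Lemma climb_path x p : path climb x p -> path (@adj G) x p.
Proof. by apply: sub_path => a b /andP[]. Qed.

Lemma climb_shortest u p : path climb u p -> shortest_path u (last u p) (u :: p).
Proof.
move=> up; apply/shortest_walkP; split.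
  by rewrite /walk !eqxx climb_path.
case=> [//|z t] /and3P[/eqP-> /eqP e /path_height].
by rewrite e (climb_height up) leq_add2l ltnS.
Qed.

Lemma climb_geodesic u a b v : connect climb u a -> climb a b ->
  connect climb b v -> exists2 s, shortest_path u v s & edge_on a b s.
Proof.
move=> /connectP[p up ea] ab /connectP[p' bp' ev].
have up' : path climb u (p ++ b :: p') by rewrite cat_path up -ea /= ab.
exists (u :: p ++ b :: p').
  have := climb_shortest up'; by rewrite last_cat /= -ev.
apply/edge_onP; case/lastP: p {up up'} ea => [|p z] ea.
  by exists [::], p'; left; rewrite ea.
by exists (u :: p), p'; left; rewrite ea last_rcons cat_rcons.
Qed.

Lemma climb_through u x v :
  connect climb u x -> connect climb x v ->
  exists2 s, shortest_path u v s & x \in s.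
Proof.
move=> /connectP[p up ->] /connectP[p' xp' ->].
exists (u :: p ++ p'); last by rewrite -cat_cons mem_cat mem_last.
have := climb_shortest (u := u) (p := p ++ p').
by rewrite cat_path last_cat up; apply.
Qed.

(** Once the ends are joined by an ascending path, the heights leave no room for
    anything but ascending steps in any of their geodesics. *)
Lemma geodesic_climbs u v s : connect climb u v -> shortest_path u v s ->
  exists2 p, s = u :: p & path climb u p /\ last u p = v.
Proof.
move=> /connectP[p up ev] /shortest_walkP[ws smin].
case: s ws smin => [//|z t] /and3P[/eqP ez /eqP lt zt] smin.
rewrite {}ez in lt zt smin *; exists t => //; split=> //.
have : size t <= size p.
  by apply: (smin (u :: p)); rewrite /walk -ev !eqxx climb_path.
have : f (last u t) = f u + size p by rewrite lt ev climb_height.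
clear - zt f_lip; elim: t u zt p => [|y t IH] u //= /andP[uy yt] p e st.
have h := path_height yt; have h' := f_lip uy.
have ey : f y = (f u).+1 by lia.
rewrite {1}/climb /= uy ey eqxx /=; apply: (IH _ yt (behead p)); rewrite ?size_behead; lia.
Qed.

(** Hence geodesics between such ends are forced through an edge as soon as its
    upper end is on them and has no other lower neighbour.  Iterating it downwards
    from [v] monitors a whole ascending path with the pair [u], [v]. *)
Lemma climb_below u v s a b : connect climb u v -> shortest_path u v s ->
  (forall x, climb x b -> x = a) -> b \in s -> b != u -> edge_on a b s /\ a \in s.
Proof.
move=> cuv ss below bs nbu.
have [p es [up _]] := geodesic_climbs cuv ss.
have bp : b \in p by move: bs; rewrite es inE (negPf nbu).
have : edge_on a b s; last by move=> e; split=> //; case: (edge_on_mem e).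
case/splitPr: bp es up => p1 p2 es; rewrite cat_path /= => /and3P[_ /below <- _].
apply/edge_onP; rewrite es; case/lastP: p1 {es} => [|p1 z].
  by exists [::], p2; left.
by exists (u :: p1), p2; left; rewrite last_rcons cat_rcons.
Qed.

Lemma climb_above u v s b : connect climb u v -> shortest_path u v s ->
  u != v -> (forall x, climb u x -> x = b) -> edge_on u b s.
Proof.
move=> cuv ss nuv above.
have [[|y p] es [up lp]] := geodesic_climbs cuv ss.
  by rewrite /= in lp; rewrite lp eqxx in nuv.
case/andP: up => /above <- _; rewrite es.
by apply/edge_onP; exists [::], p; left.
Qed.

End GeodesicCalculus.

(** * Minimal cardinality *)

(** The image of [h] has at most #|J| elements; the lower bound makes this an
    equality. *)
Lemma min_card_le (G : sgraph) (Q : {set G} -> Prop) (J : finType) (h : J -> G) :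
  Q (h @: setT) -> (forall S, Q S -> #|J| <= #|S|) -> min_card Q #|J|.
Proof.
move=> Qh lo; split=> //; exists (h @: setT); split=> //.
by apply/eqP; rewrite eqn_leq lo // andbT -cardsT leq_imset_card.
Qed.

Lemma leq_card_inj (G J : finType) (S : {set G}) (h : J -> G) :
  injective h -> (forall i, h i \in S) -> #|J| <= #|S|.
Proof.
move=> hinj hS; rewrite -cardsT -(card_imset _ hinj); apply: subset_leq_card.
by apply/subsetP => _ /imsetP[i _ ->].
Qed.

(** * The graph *)

Section Construction.

Variables (n m k q : nat) (I : finType) (t0 : I) (mu : 'I_k.+1 -> I).

(** Middle vertices are indexed by an abstract type, with [mu j] below Spoke j and
    [t0] below Hub and the sides: the parity of meg - seg depends on whether [mu]
    merges them all or keeps them apart. *)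
Inductive node : Type :=
| Tail | Joint of 'I_n.+1 | Twin of bool & 'I_n | Mid of I | Hub
| Side of 'I_m | Spoke of 'I_k.+1 | Apex | Leaf of 'I_q.+1.

Definition node_code (v : node) :
  option (option (option ('I_n.+1 + bool * 'I_n + I + 'I_m + 'I_k.+1 + 'I_q.+1))) :=
  match v with
  | Tail => None
  | Hub => Some None
  | Apex => Some (Some None)
  | Joint i => Some (Some (Some (inl (inl (inl (inl (inl i)))))))
  | Twin b i => Some (Some (Some (inl (inl (inl (inl (inr (b, i))))))))
  | Mid t => Some (Some (Some (inl (inl (inl (inr t))))))
  | Side i => Some (Some (Some (inl (inl (inr i)))))
  | Spoke j => Some (Some (Some (inl (inr j))))
  | Leaf i => Some (Some (Some (inr i)))
  end.

Definition node_decode c : node :=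
  match c with
  | None => Tail
  | Some None => Hub
  | Some (Some None) => Apex
  | Some (Some (Some (inl (inl (inl (inl (inl i))))))) => Joint i
  | Some (Some (Some (inl (inl (inl (inl (inr (b, i)))))))) => Twin b i
  | Some (Some (Some (inl (inl (inl (inr t)))))) => Mid t
  | Some (Some (Some (inl (inl (inr i))))) => Side i
  | Some (Some (Some (inl (inr j)))) => Spoke j
  | Some (Some (Some (inr i))) => Leaf i
  end.

Lemma node_codeK : cancel node_code node_decode.
Proof. by case. Qed.

HB.instance Definition _ := Finite.copy node (can_type node_codeK).

(** The edges that raise [height] by one, oriented upwards. *)
Definition up (u v : node) : bool :=
  match u, v with
  | Tail, Joint i => i == 0 :> nat
  | Joint i, Twin _ j => i == j :> nat
  | Twin _ j, Joint i => i == j.+1 :> nat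
  | Joint i, Mid _ => i == n :> nat
  | Mid t, Hub => t == t0
  | Mid t, Side _ => t == t0
  | Mid t, Spoke j => t == mu j
  | Hub, Apex => true
  | Side _, Apex => true
  | Spoke _, Apex => true
  | Hub, Leaf _ => true
  | _, _ => false
  end.

Definition rung (u v : node) : bool :=
  match u, v with Hub, Side _ => true | _, _ => false end.

Definition height (v : node) : nat :=
  match v with
  | Tail => 0
  | Joint i => i.*2.+1
  | Twin _ i => i.*2.+2
  | Mid _ => n.*2.+2
  | Hub | Side _ | Spoke _ => n.*2.+3
  | Apex | Leaf _ => n.*2.+4
  end.

Definition adjacent : rel node :=
  [rel u v | [|| up u v, up v u, rung u v | rung v u]].

Lemma up_height u v : up u v -> height v = (height u).+1.
Proof.
by case: u v => [|i|b i|t||i|j||i] [|i'|b' i'|t'||i'|j'||i'] //= /eqP -> //;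
  rewrite doubleS.
Qed.

Lemma adjacent_sym : symmetric adjacent.
Proof.
move=> u v; rewrite /adjacent /=.
by case: (up u v); case: (up v u); case: (rung u v); case: (rung v u).
Qed.

Lemma adjacent_irrefl : irreflexive adjacent.
Proof. by case=> [|i|b i|t||i|j||i]. Qed.

Definition core : sgraph := SGraph adjacent_sym adjacent_irrefl.

Lemma adjE (u v : core) : adj u v = [|| up u v, up v u, rung u v | rung v u].
Proof. by []. Qed.

Lemma climbE (u v : core) : @climb core height u v = up u v.
Proof.
have -> : @climb core height u v = adj u v && (height v == (height u).+1) by [].
rewrite adjE; apply/idP/idP => [|uv]; last first.
  by rewrite uv (up_height uv) eqxx.
case/andP=> /or4P[//|/up_height->|r|r]; first lia.
- by case: u v r => [|?|? ?|?||?|?||?] [|?|? ?|?||?|?||?] //= _; lia.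
- by case: u v r => [|?|? ?|?||?|?||?] [|?|? ?|?||?|?||?] //= _; lia.
Qed.

Lemma height_lip (u v : core) : adj u v -> height v <= (height u).+1.
Proof.
rewrite adjE => /or4P[/up_height->//|/up_height->|r|r]; first lia.
- by case: u v r => [|?|? ?|?||?|?||?] [|?|? ?|?||?|?||?].
- by case: u v r => [|?|? ?|?||?|?||?] [|?|? ?|?||?|?||?].
Qed.

Notation climbs := (connect (climb (G := core) height)).

Lemma climbs1 (u v : core) : up u v -> climbs u v.
Proof. by rewrite -climbE; apply: connect1. Qed.

(* Otherwise some middle vertex would be a dead end. *)
Hypothesis mu_onto : forall t, t = t0 \/ exists j, t = mu j.

Let top : core := Joint ord_max.

Lemma joint_climbs (i j : 'I_n.+1) : i <= j -> climbs (Joint i) (Joint j).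
Proof.
case: j => j; elim: j => [|j IH] lj le_ij.
  by rewrite (_ : i = Ordinal lj) //; apply: val_inj => /=; move: le_ij => /=; lia.
have [e|lt_ij] := eqVneq (i : nat) j.+1.
  by rewrite (_ : i = Ordinal lj) //; apply: val_inj.
have lj' : j < n.+1 by lia.
have lj'' : j < n by lia.
apply: connect_trans (IH lj' _) _; first by move: le_ij => /=; lia.
apply: (connect_trans (y := Twin true (Ordinal lj''))); apply: climbs1 => //=.
Qed.

Lemma tail_climbs_joint i : climbs Tail (Joint i).
Proof.
by apply: connect_trans (joint_climbs (i := ord0) _) => //; apply: climbs1.
Qed.

Lemma tail_climbs_mid t : climbs Tail (Mid t).
Proof.
by apply: connect_trans (tail_climbs_joint ord_max) _; apply: climbs1 => /=.
Qed.

Lemma tail_climbs (v : core) : climbs Tail v.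
Proof.
have hub : climbs Tail Hub.
  by apply: connect_trans (tail_climbs_mid t0) _; apply: climbs1 => /=.
case: v => [|i|b i|t||i|j||i] //; first exact: tail_climbs_joint.
- apply: connect_trans (tail_climbs_joint (widen_ord (leqnSn n) i)) _.
  by apply: climbs1 => /=.
- exact: tail_climbs_mid.
- by apply: connect_trans (tail_climbs_mid t0) _; apply: climbs1 => /=.
- by apply: connect_trans (tail_climbs_mid (mu j)) _; apply: climbs1 => /=.
- by apply: connect_trans hub _; apply: climbs1.
- by apply: connect_trans hub _; apply: climbs1.
Qed.

Lemma core_connected : connected_graph core.
Proof.
split; first by apply/card_gt0P; exists Tail.
have tl (v : core) : connect (@adj core) Tail v.
  by apply: connect_sub (tail_climbs v) => a b /andP[/connect1].
move=> u v; apply: connect_trans (tl v).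
by rewrite (sym_connect_sym (@adj_sym core)).
Qed.

Definition in_chain (v : core) : bool :=
  match v with Tail | Joint _ | Twin _ _ => true | _ => false end.

(** The possible partners of Apex for covering a spoke, as [spoke_ends] shows. *)
Definition below_hub (v : core) : bool :=
  if v is Mid t then t == t0 else in_chain v.

Lemma joint_climbs_mid i t : climbs (Joint i) (Mid t).
Proof.
apply: connect_trans (joint_climbs (j := ord_max) _) _; first exact: leq_ord.
by apply: climbs1 => /=.
Qed.

Lemma below_hub_climbs (v : core) : below_hub v -> climbs v Hub.
Proof.
have mid : climbs (Mid t0) Hub by apply: climbs1 => /=.
case: v => [|i|b i|t||i|j||i] //=.
- by rewrite tail_climbs.
- by move=> _; apply: connect_trans (joint_climbs_mid _ _) mid.
- move=> _; apply: connect_trans (connect_trans _ (joint_climbs_mid (lift ord0 i) _)) mid.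
  by apply: climbs1 => /=.
- by move=> /eqP->.
Qed.

Definition is_leaf (v : core) : bool := if v is Leaf _ then true else false.

Lemma climbs_apex (v : core) : ~~ is_leaf v -> climbs v Apex.
Proof.
have hub : climbs Hub Apex by apply: climbs1.
case: v => [|i|b i|t||i|j||i] //=.
- by rewrite tail_climbs.
- by move=> _; apply: connect_trans (below_hub_climbs (v := Joint i) _) hub.
- by move=> _; apply: connect_trans (below_hub_climbs (v := Twin b i) _) hub.
- move=> _; have [->|[j ->]] := mu_onto t.
    by apply: connect_trans (below_hub_climbs (v := Mid t0) _) hub => /=.
  by apply: (connect_trans (y := Spoke j)); apply: climbs1 => /=.
- by move=> _; apply: climbs1.
- by move=> _; apply: climbs1.
Qed.

Local Arguments adj : simpl never.

(** * Geodesics through a spoke *)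

Lemma adj_spoke j (y : core) : @adj core (Spoke j) y -> y = Mid (mu j) \/ y = Apex.
Proof.
rewrite adjE; case: y => [|?|? ?|?||?|?||?] //=; last by right.
by rewrite !orbF => /eqP->; left.
Qed.

(** Every lower neighbour of Apex is also an upper neighbour of some middle vertex;
    this gives the shortcuts and exchanges at Apex. *)
Lemma adj_apex (y : core) : @adj core Apex y ->
  @adj core y Apex /\ exists t, @adj core (Mid t) y /\ (mu =1 (fun=> t0) -> t = t0).
Proof.
rewrite adj_sym => ay; split=> //.
case: y ay => [|?|? ?|?||i|j||?] // _; [exists t0|exists t0|exists (mu j)];
  by split=> //; rewrite adjE /= eqxx.
Qed.

Lemma adj_mid t (y : core) : @adj core y (Mid t) -> y = top \/ @adj core y Apex.
Proof.
rewrite !adjE; case: y => [|i|? ?|?||?|j||?] //=; try by right.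
by rewrite orbF => /eqP e; left; congr Joint; apply: val_inj.
Qed.

(** If the path extended beyond both Mid (mu j) and Apex, to [a] and [y] say, then a
    shortcut of length at most two from [a] to Apex or to [y] would exist: either
    [a] is adjacent to Apex, or [a] is the last joint, which sees all middle
    vertices. *)
Lemma through_spoke (u v : core) s1 s2 j :
  shortest_path u v (s1 ++ [:: (Spoke j : core), (Apex : core) & s2]) ->
  u != Spoke j -> exists s0,
    s1 = rcons s0 (Mid (mu j)) /\ (s0 = [::] \/ s2 = [::]).
Proof.
case: (lastP s1) => [|s0 x] ss nu; first by rewrite (shortest_first ss) eqxx in nu.
have := shortest_uniq ss; rewrite cat_uniq !rcons_uniq => /and5P[_ /hasPn nx _ _ _].
rewrite cat_rcons in ss.
have := shortest_adj ss; rewrite adj_sym => /adj_spoke[] ex; last first.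
  by have := nx Apex; rewrite ex !inE mem_rcons inE eqxx orbT => /(_ isT).
exists s0; rewrite ex in ss *; split=> //.
case: (lastP s0) ss => [|s0' a] ss; first by left.
case: s2 ss {nx} => [|y s2] ss; first by right.
exfalso; rewrite cat_rcons in ss.
have /adj_apex[_ [t [ty _]]] : @adj core Apex y.
  by move: ss; rewrite -2!cat_rcons -cat_rcons => /shortest_adj.
have [ea|aA] := adj_mid (shortest_adj ss).
  have pq : path (@adj core) a [:: Mid t; y].
    by rewrite /= ty ea adjE /= eqxx.
  by have := shortest_sub (p := [:: (Mid (mu j) : core); Spoke j; Apex; y]) ss pq erefl.
have pq : path (@adj core) a [:: Apex] by rewrite /= aA.
by have := shortest_sub (p := [:: (Mid (mu j) : core); Spoke j; Apex])
   (s2 := y :: s2) ss pq erefl.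
Qed.

(** Outside the chain every vertex is within distance two of Apex. *)
Lemma far_from_apex (u : core) s : @shortest_path core u Apex s -> 3 < size s ->
  in_chain u.
Proof.
move=> /shortest_walkP[_ smin]; apply: contraTT => nu; rewrite -leqNgt.
case: u smin nu => [|i|b i|t||i|j||i] // smin _.
- case: (mu_onto t) smin => [->|[j ->]] smin.
    by apply: (smin [:: (Mid t0 : core); Hub; Apex]); rewrite /walk /= ?adjE /= ?eqxx.
  by apply: (smin [:: (Mid (mu j) : core); Spoke j; Apex]); rewrite /walk /= ?adjE /= ?eqxx.
- by apply: leq_trans (smin [:: (Hub : core); Apex] _) _; rewrite /walk /= ?adjE /= ?eqxx.
- by apply: leq_trans (smin [:: (Side i : core); Apex] _) _; rewrite /walk /= ?adjE /= ?eqxx.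
- by apply: leq_trans (smin [:: (Spoke j : core); Apex] _) _; rewrite /walk /= ?adjE /= ?eqxx.
- by apply: leq_trans (smin [:: (Apex : core)] _) _; rewrite /walk /= ?eqxx.
- by apply: leq_trans (smin [:: (Leaf i : core); Hub; Apex] _) _; rewrite /walk /= ?adjE /= ?eqxx.
Qed.

(* The two extreme ways of attaching the spokes. *)
Hypothesis mu_split : mu =1 (fun=> t0) \/ (injective mu /\ forall j, mu j != t0).

(** By [through_spoke], a geodesic crossing the edge Spoke j -- Apex without ending
    in Spoke j starts at Mid (mu j) or ends in Apex.  In the latter case it comes
    from the chain, or from the only middle vertex when all are merged.  In the
    former case, a middle vertex shared with Hub would have a shortcut past
    Apex. *)
Lemma spoke_ends (S : {set core}) (u v : core) s j :
  u \in S -> v \in S -> shortest_path u v s -> edge_on (Spoke j : core) Apex s ->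
  [\/ (Spoke j : core) \in S, mu j != t0 /\ (Mid (mu j) : core) \in S |
      exists w : core, [/\ w \in S, (Apex : core) \in S, below_hub w
                         & u = w /\ v = Apex \/ u = Apex /\ v = w]].
Proof.
move=> uS vS ss es.
have [u' [v' [s1 [s2 [uv ss']]]]] := orient_edge ss es.
have u'S : u' \in S by case: uv => -[-> _].
have v'S : v' \in S by case: uv => -[_ ->].
have [eu|nu] := eqVneq u' (Spoke j); first by rewrite -eu; constructor 1.
have [s0 [es1 s02]] := through_spoke ss' nu.
rewrite {s1}es1 in ss'.
have midu : s0 = [::] -> u' = Mid (mu j).
  by move=> e; move: ss'; rewrite e => /shortest_first.
have us2 : s2 = [::] -> v' = Apex.
  by move=> e; move: ss'; rewrite e -cat_rcons cats1 => /shortest_last.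
have [/eqP e0|n0] := boolP (s0 == [::]).
  have [tj|] := eqVneq (mu j) t0; last first.
    by move=> ntj; constructor 2; rewrite -midu.
  case: s2 ss' s02 us2 => [|y s2] ss' _ us2; last first.
    have mu0 : mu =1 (fun=> t0).
      by case: mu_split => // -[_ /(_ j)]; rewrite tj eqxx.
    have /adj_apex[_ [t [+ /(_ mu0) et]]] : @adj core Apex y.
      by move: ss'; rewrite -cat_rcons => /shortest_adj.
    rewrite et -tj => ty; rewrite cat_rcons in ss'.
    have pq : path (@adj core) (Mid (mu j)) [:: y] by rewrite /= ty.
    by have := shortest_sub (p := [:: (Spoke j : core); Apex; y]) ss' pq erefl.
  constructor 3; exists u'; rewrite -{1}us2 // v'S; split=> //.
    by rewrite midu //= tj.
  by case: uv => -[<- <-]; rewrite us2; auto.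
case: s02 => e2; first by rewrite e2 in n0.
constructor 3; exists u'; rewrite -{1}us2 // v'S; split=> //.
  rewrite us2 // in ss'.
  have /(far_from_apex ss') :
      3 < size (rcons s0 (Mid (mu j)) ++ [:: (Spoke j : core), (Apex : core) & s2]).
    by rewrite size_cat size_rcons /=; case: (s0) n0 => //= *; lia.
  by case: (u').
by case: uv => -[<- <-]; rewrite us2; auto.
Qed.

(** * Lower bounds *)

Lemma tail_forced (S : {set core}) : edge_geodetic_set S -> (Tail : core) \in S.
Proof.
apply: (eg_forced (x := Joint ord0 : core)); first by rewrite adjE.
by case=> [|i|b i|t||i|j||i] //=; rewrite adjE //= !orbF => /eqP e /eqP[];
  congr Joint; apply: val_inj.
Qed.

Lemma leaf_forced (S : {set core}) i : edge_geodetic_set S -> (Leaf i : core) \in S.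
Proof.
apply: (eg_forced (x := Hub : core)); first by rewrite adjE.
by case=> [|?|? ?|?||?|?||?] //=; rewrite adjE.
Qed.

Lemma side_forced (S : {set core}) i : edge_geodetic_set S -> (Side i : core) \in S.
Proof.
apply: (eg_forced (x := Hub : core)); first by rewrite adjE.
by case=> [|?|? ?|?||?|?||?] //=; rewrite !adjE /= ?orbF.
Qed.

Lemma twin_forced (S : {set core}) b i : meg_set S -> (Twin b i : core) \in S.
Proof.
pose x : core := Joint (widen_ord (leqnSn n) i).
have xT b' : @adj core x (Twin b' i) by rewrite adjE /= eqxx.
apply: (meg_forced core_connected (xT b)) => y yT nyx; right.
exists (Twin (~~ b) i); split; first by case: (b).
- exact: xT.
case: y yT nyx => [|?|? ?|?||?|?||?] //; rewrite !adjE //=.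
Qed.

(** The [_pick] maps enumerate both the small sets of the upper bounds and, inside an
    arbitrary set with the relevant property, enough vertices for the lower
    bounds; the arguments [x] and [phi] stand for the vertices that such a set is
    free to choose. *)
Definition geo_pick (x : core) (i : option (option ('I_q.+1))) : core :=
  match i with
  | None => x
  | Some None => Tail
  | Some (Some i) => Leaf i
  end.

Definition eg_pick (x : core) (i : option (option ('I_q.+1 + 'I_m))) : core :=
  match i with
  | None => x
  | Some None => Tail
  | Some (Some (inl i)) => Leaf i
  | Some (Some (inr i)) => Side i
  end.

Definition seg_pick (x : core) (phi : 'I_k.+1 -> core)
    (i : option ('I_q.+1 + 'I_m + 'I_k.+1)) : core :=
  match i with
  | None => x
  | Some (inl (inl i)) => Leaf i
  | Some (inl (inr i)) => Side i
  | Some (inr j) => phi j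
  end.

Definition meg_pick (phi : 'I_k.+1 -> core)
    (i : option ('I_q.+1 + 'I_m + 'I_k.+1 + bool * 'I_n)) : core :=
  match i with
  | None => Tail
  | Some (inl (inl (inl i))) => Leaf i
  | Some (inl (inl (inr i))) => Side i
  | Some (inl (inr j)) => phi j
  | Some (inr (b, i)) => Twin b i
  end.

Definition meg_pick_apex (phi : 'I_k.+1 -> core)
    (i : option (option ('I_q.+1 + 'I_m + 'I_k.+1 + bool * 'I_n))) : core :=
  if i is Some i' then meg_pick phi i' else Apex.

Lemma geodetic_lower (S : {set core}) : geodetic_set S ->
  #|{: option (option ('I_q.+1))}| <= #|S|.
Proof.
move=> gS.
have tS : (Tail : core) \in S.
  apply: (geodetic_leaf (x := Joint ord0 : core)) gS.
  by case=> [|i|? ?|?||?|?||?] //; rewrite adjE /= !orbF => /eqP e;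
    congr Joint; apply: val_inj.
have lS i : (Leaf i : core) \in S.
  apply: (geodetic_leaf (x := Hub : core)) gS.
  by case=> [|?|? ?|?||?|?||?] //; rewrite adjE.
have [x xS nx] : exists2 x : core, x \in S &
    match x with Tail | Leaf _ => false | _ => true end.
  have [u [v [s [uS vS _ ss zs]]]] := gS (Spoke ord0).
  have [eu|nu] := eqVneq (Spoke ord0 : core) u; first by exists u => //; rewrite -eu.
  have [ev|nv] := eqVneq (Spoke ord0 : core) v; first by exists v => //; rewrite -ev.
  have es := edge_on_inner ss zs nu nv (@adj_spoke ord0).
  have [zS|[_ MS]|[w [_ AS _ _]]] := spoke_ends uS vS ss es.
  - by exists (Spoke ord0).
  - by exists (Mid (mu ord0)).
  - by exists Apex.
apply: (leq_card_inj (h := geo_pick x)) => [|[[i|]|]] //=.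
case=> [[i|]|] [[j|]|] //=; try by [move=> e; rewrite -e in nx | move=> e; rewrite e in nx].
by case=> ->.
Qed.

Lemma edge_geodetic_lower (S : {set core}) : edge_geodetic_set S ->
  #|{: option (option ('I_q.+1 + 'I_m))}| <= #|S|.
Proof.
move=> eS.
have [x xS nx] : exists2 x : core, x \in S &
    match x with Tail | Leaf _ | Side _ => false | _ => true end.
  have /eS[u [v [s [uS vS _ ss es]]]] : @adj core (Spoke ord0) Apex by rewrite adjE.
  have [zS|[_ MS]|[w [_ AS _ _]]] := spoke_ends uS vS ss es.
  - by exists (Spoke ord0).
  - by exists (Mid (mu ord0)).
  - by exists Apex.
apply: (leq_card_inj (h := eg_pick x)) => [|[[[i|i]|]|]] //=; last first.
- exact: tail_forced.
- exact: side_forced.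
- exact: leaf_forced.
case=> [[[i|i]|]|] [[[j|j]|]|] //=;
  try by [move=> e; rewrite -e in nx | move=> e; rewrite e in nx | case=> ->].
Qed.

(** Each spoke is charged to a vertex [phi j] of the set, by [spoke_ends].  Two spokes
    cannot be charged to the same [w]: the path chosen for {w, Apex} enters Apex
    only once. *)
Lemma strong_lower (S : {set core}) : strong_edge_geodetic_set S ->
  #|{: option ('I_q.+1 + 'I_m + 'I_k.+1)}| <= #|S|.
Proof.
move=> sS; have eS := seg_eg sS; case: sS => P [Psh Pcov].
pose A : core := Apex.
have [phi phiP] : exists phi : 'I_k.+1 -> core, forall j, phi j \in S /\
    [\/ phi j = Spoke j, mu j != t0 /\ phi j = Mid (mu j) |
        [/\ A \in S, below_hub (phi j) &
            edge_on (Spoke j : core) A (P [set phi j; A])]].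
  apply: (@fin_all_exists _ (fun=> core) (fun j y => y \in S /\
    [\/ y = Spoke j, mu j != t0 /\ y = Mid (mu j) |
        [/\ A \in S, below_hub y & edge_on (Spoke j : core) A (P [set y; A])]])) => j.
  have /Pcov[u [v [uS vS nuv es]]] : @adj core (Spoke j) A by rewrite adjE.
  have ends : [\/ (Spoke j : core) \in S, mu j != t0 /\ (Mid (mu j) : core) \in S |
      exists w : core, [/\ w \in S, A \in S, below_hub w
                         & u = w /\ v = Apex \/ u = Apex /\ v = w]].
    have [ss|ss] := Psh u v uS vS nuv; first exact: spoke_ends ss es.
    have [?|?|[w [? ? ? uv]]] := spoke_ends vS uS ss es;
      [by constructor 1 | by constructor 2 | constructor 3; exists w; split=> //].
    by case: uv => -[-> ->]; auto.
  case: ends => [zS|[nj MS]|[w [wS AS bw uv]]].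
  - by exists (Spoke j); split=> //; constructor 1.
  - by exists (Mid (mu j)); split=> //; constructor 2.
  - exists w; split=> //; constructor 3; split=> //.
    by case: uv es => -[-> ->] //; rewrite setUC.
have phi_sort j : (match phi j with
    | Leaf _ | Side _ | Apex | Hub => false
    | Tail => A \in S | _ => true end : bool).
  have [_ [->|[_ ->]|[AS + _]]] := phiP j; rewrite // AS.
  by case: (phi j).
have phi_inj : injective phi.
  move=> i j eij; have [_ iP] := phiP i; have [jS jP] := phiP j.
  rewrite eij in iP.
  case: iP jP => [->|[ni ->]|[AS bi ei]] [e|[nj e]|[_ bj ej]] //.
  - by case: e.
  - by case: e => emu; case: mu_split => [mu0|[mu_inj _]];
      [rewrite mu0 eqxx in ni | apply: mu_inj].
  - by rewrite /= (negPf ni) in bj.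
  - by rewrite e in bi.
  - by rewrite e /= (negPf nj) in bi.
  have nA : phi j != A by apply: contraTneq bj => ->.
  suff [] : (Spoke i : core) = Spoke j by [].
  case: (Psh _ _ jS AS nA) => ss; first exact: last_edge ss ei ej.
  by apply: (last_edge (shortest_rev ss)); rewrite edge_on_rev.
(* Some spoke charged to Tail means that Apex is in the set; so Apex, or else Tail,
   is a further vertex outside the range of [phi]. *)
apply: (leq_card_inj (h := seg_pick (if A \in S then A else Tail) phi)).
  case=> [[[i|i]|i]|] [[[j|j]|j]|] //=; try by [case=> -> | case: ifP].
  - by move=> e; have := phi_sort j; rewrite -e.
  - by move=> e; have := phi_sort j; rewrite -e.
  - by move=> e; have := phi_sort i; rewrite e.
  - by move=> e; have := phi_sort i; rewrite e.
  - by move/phi_inj ->.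
  - by move=> e; have := phi_sort i; rewrite e; case: ifP.
  - by move=> e; have := phi_sort j; rewrite -e; case: ifP => // ->.
case=> [[[i|i]|j]|] /=.
- exact: leaf_forced.
- exact: side_forced.
- by case: (phiP j).
- by case: ifP => // _; apply: tail_forced.
Qed.

(** In a monitoring set no spoke can be charged to a vertex [w] below Hub: some
    geodesic from [w] to Apex goes through Hub and avoids the spoke. *)
Lemma meg_spoke (S : {set core}) j : meg_set S ->
  (Spoke j : core) \in S \/ mu j != t0 /\ (Mid (mu j) : core) \in S.
Proof.
move=> mS; have eA : @adj core (Spoke j) Apex by rewrite adjE.
have [u [v [uS vS nuv mon]]] := mS _ _ eA.
have [s ss] := shortest_exists (core_connected.2 u v).
have [|[? ?]|[w [wS AS bw uv]]] := spoke_ends uS vS ss (mon _ ss); auto.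
have [s' ss' hs'] := climb_geodesic height_lip (below_hub_climbs bw)
  (etrans (climbE Hub Apex) erefl) (connect0 _ _).
have /(last_edge ss' hs') // : edge_on (Spoke j : core) Apex s'.
case: uv mon => -[-> ->] mon; first exact: mon.
by rewrite -edge_on_rev; apply/mon/shortest_rev.
Qed.

(** With all middle vertices merged, Mid t0 can replace Apex in any geodesic that
    passes through Apex. *)
Lemma meg_apex (S : {set core}) : mu =1 (fun=> t0) -> meg_set S -> (Apex : core) \in S.
Proof.
move=> mu0; apply: (meg_forced core_connected (x := Spoke ord0 : core)).
  by rewrite adjE.
move=> y /adj_apex[_ [t [ty /(_ mu0) et]]] _; right; exists (Mid t0).
by split; rewrite -?et // adjE /= et mu0 eqxx.
Qed.

Definition on_spoke (v : core) : bool :=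
  match v with Spoke _ | Mid _ => true | _ => false end.

Lemma meg_choice (S : {set core}) : meg_set S -> exists phi : 'I_k.+1 -> core,
  [/\ forall j, phi j \in S, injective phi &
      forall j, on_spoke (phi j)].
Proof.
move=> mS.
have [phi phiP] : exists phi : 'I_k.+1 -> core, forall j, phi j \in S /\
    (phi j = Spoke j \/ mu j != t0 /\ phi j = Mid (mu j)).
  apply: (@fin_all_exists _ (fun=> core) (fun j y => y \in S /\
    (y = Spoke j \/ mu j != t0 /\ y = Mid (mu j)))) => j.
  have [zS|[nj MS]] := meg_spoke j mS; first by exists (Spoke j); auto.
  by exists (Mid (mu j)); auto.
exists phi; split=> [j|i j|j]; first by case: (phiP j).
- have [_ [->|[ni ->]]] := phiP i; have [_ [->|[nj ->]]] := phiP j; try by case.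
  case=> emu; case: mu_split => [mu0|[mu_inj _]]; last exact: mu_inj.
  by rewrite mu0 eqxx in ni.
- by have [_ [->|[_ ->]]] := phiP j.
Qed.

Lemma meg_pick_inj (phi : 'I_k.+1 -> core) : injective phi ->
  (forall j, on_spoke (phi j)) ->
  injective (meg_pick phi).
Proof.
move=> phi_inj phi_sort.
case=> [[[[i|i]|i]|[b i]]|] [[[[j|j]|j]|[c j]]|] //=; try by [case=> -> | case=> -> ->];
  try by [move=> e; have := phi_sort j; rewrite -e
         |move=> e; have := phi_sort i; rewrite e].
by move/phi_inj ->.
Qed.

Lemma meg_pick_in (S : {set core}) (phi : 'I_k.+1 -> core) : meg_set S ->
  (forall j, phi j \in S) -> forall i, meg_pick phi i \in S.
Proof.
move=> mS phiS [[[[i|i]|j]|[b i]]|] /=.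
- exact: leaf_forced (meg_eg core_connected mS).
- exact: side_forced (meg_eg core_connected mS).
- exact: phiS.
- exact: twin_forced.
- exact: tail_forced (meg_eg core_connected mS).
Qed.

Lemma meg_lower (S : {set core}) : meg_set S ->
  #|{: option ('I_q.+1 + 'I_m + 'I_k.+1 + bool * 'I_n)}| <= #|S|.
Proof.
move=> mS; have [phi [phiS phi_inj phi_sort]] := meg_choice mS.
apply: leq_card_inj (meg_pick_inj phi_inj phi_sort) _.
exact: meg_pick_in.
Qed.

Lemma meg_lower_merged (S : {set core}) : mu =1 (fun=> t0) -> meg_set S ->
  #|{: option (option ('I_q.+1 + 'I_m + 'I_k.+1 + bool * 'I_n))}| <= #|S|.
Proof.
move=> mu0 mS; have [phi [phiS phi_inj phi_sort]] := meg_choice mS.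
have nA i : meg_pick phi i != Apex.
  case: i => [[[[i|i]|j]|[b i]]|] //=.
  by apply: contraTneq (phi_sort j) => ->.
apply: (leq_card_inj (h := meg_pick_apex phi)) => [|[i|]] /=.
- case=> [i|] [j|] //=.
  + by move/(meg_pick_inj phi_inj phi_sort) ->.
  + by move/eqP; rewrite (negPf (nA i)).
  + by move/esym/eqP; rewrite (negPf (nA j)).
- exact: meg_pick_in.
- exact: meg_apex.
Qed.

(** * Upper bounds *)

Lemma up_to_leaf (v : core) i : up v (Leaf i) -> v = Hub.
Proof. by case: v. Qed.

Lemma geodetic_upper : geodetic_set (geo_pick Apex @: setT).
Proof.
set S := _ @: _; have inS i : geo_pick Apex i \in S by apply: imset_f.
have tS : (Tail : core) \in S := inS (Some None).
have through x v : climbs x v -> v \in S -> v != Tail -> exists u v' s,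
    [/\ u \in S, v' \in S, u != v', shortest_path u v' s & x \in s].
  move=> xv vS nv; have [s ss xs] := climb_through height_lip (tail_climbs x) xv.
  by exists Tail, v, s; split; rewrite // eq_sym.
move=> x; have [[i ->]|/climbs_apex/through] :
    (exists i, x = Leaf i) \/ ~~ is_leaf x.
  by case: x => *; auto; left; eexists.
- by apply: (through _ (Leaf i)) => //; apply: (inS (Some (Some i))).
- by apply=> //; apply: (inS None).
Qed.

Lemma core_adj_ind (R : core -> core -> Prop) :
  (forall x y, R x y -> R y x) -> (forall x y : core, up x y -> R x y) ->
  (forall i, R Hub (Side i)) -> forall x y : core, adj x y -> R x y.
Proof.
move=> Rsym Rup Rrung x y; rewrite adjE => /or4P[/Rup|/Rup/Rsym||] //.
- by case: x y => [|?|? ?|?||?|?||?] [|?|? ?|?||?|?||?].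
- by move=> r; apply: Rsym; case: x y r => [|?|? ?|?||?|?||?] [|?|? ?|?||?|?||?].
Qed.

Lemma leaf_hub_side l i : shortest_path (Leaf l : core) (Side i) [:: (Leaf l : core); Hub; Side i].
Proof. by apply: shortest2; rewrite // adjE. Qed.

Lemma edge_geodetic_upper : edge_geodetic_set (eg_pick Apex @: setT).
Proof.
set S := _ @: _; have inS i : eg_pick Apex i \in S by apply: imset_f.
have tS : (Tail : core) \in S := inS (Some None).
have on_climb (x y v : core) : up x y -> climbs y v -> v \in S -> v != Tail ->
    exists u v' s, [/\ u \in S, v' \in S, u != v', shortest_path u v' s & edge_on x y s].
  rewrite -climbE => xy yv vS nv.
  have [s ss xs] := climb_geodesic height_lip (tail_climbs x) xy yv.
  by exists Tail, v, s; split; rewrite // eq_sym.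
apply: core_adj_ind => [x y [u [v [s [uS vS nuv ss es]]]]|x y xy|i].
- by exists u, v, s; split=> //; rewrite edge_onC.
- have [[i ey]|/climbs_apex cy] :
    (exists i, y = Leaf i) \/ ~~ is_leaf y.
    by case: (y) => *; auto; left; eexists.
  + by apply: (on_climb _ _ _ xy (connect0 _ _)); rewrite ey //; apply: (inS (Some (Some (inl i)))).
  + by apply: (on_climb _ _ _ xy cy) => //; apply: (inS None).
- exists (Leaf ord0), (Side i), [:: (Leaf ord0 : core); Hub; Side i]; split=> //.
  + exact: (inS (Some (Some (inl ord0)))).
  + exact: (inS (Some (Some (inr i)))).
  + exact: leaf_hub_side.
  + by rewrite /edge_on /= !inE eqxx !orbT.
Qed.

(** Up the chain, always on the side [b]. *)
Lemma chain_path (b : bool) : exists p : seq core,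
  [/\ path (up : rel core) Tail p, last (Tail : core) p = top,
      edge_on (Tail : core) (Joint ord0) (Tail :: p) &
      forall i : 'I_n,
        edge_on (Joint (widen_ord (leqnSn n) i) : core) (Twin b i) (Tail :: p) /\
        edge_on (Twin b i : core) (Joint (lift ord0 i)) (Tail :: p)].
Proof.
suff A i (li : i < n.+1) : exists p : seq core,
  [/\ path (up : rel core) Tail p, last (Tail : core) p = Joint (Ordinal li),
      edge_on (Tail : core) (Joint ord0) (Tail :: p) &
      forall j : 'I_n, j < i ->
        edge_on (Joint (widen_ord (leqnSn n) j) : core) (Twin b j) (Tail :: p) /\
        edge_on (Twin b j : core) (Joint (lift ord0 j)) (Tail :: p)].
  have [p [pp lp e0 ep]] := A n (ltnSn n); exists p; split=> //.
  by move=> i; apply: ep.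
elim: i li => [|i IH] li.
  by exists [:: Joint ord0 : core]; split=> //; congr Joint; apply: val_inj.
have li' : i < n.+1 by lia.
have ln : i < n by lia.
have [p [pp lp e0 ep]] := IH li'.
pose y : core := Twin b (Ordinal ln); pose z : core := Joint (Ordinal li).
exists (p ++ [:: y; z]); split.
- by rewrite cat_path pp lp /= !eqxx.
- by rewrite last_cat.
- by rewrite -cat_cons; apply: edge_on_cat.
move=> j; rewrite ltnS leq_eqVlt => /orP[/eqP ej|/ep[e1 e2]]; last first.
  by rewrite -cat_cons; split; apply: edge_on_cat.
have -> : Twin b j = y by congr Twin; apply: val_inj.
have -> : Joint (widen_ord (leqnSn n) j) = last (Tail : core) p.
  by rewrite lp; congr Joint; apply: val_inj.
have -> : Joint (lift ord0 j) = z.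
  by congr Joint; apply: val_inj => /=; rewrite /bump /= ej.
split; first exact: edge_on_join.
rewrite -cat_rcons.
have := edge_on_join (G := core) Tail z (rcons p y) [::].
by rewrite last_rcons.
Qed.

Lemma spoke_to_leaf j i :
  shortest_path (Spoke j : core) (Leaf i) [:: (Spoke j : core); Apex; Hub; Leaf i].
Proof.
apply/shortest_walkP; split; first by rewrite /walk /= ?adjE /= ?eqxx.
case=> [|z [|w [|x [|? ?]]]] //= /and3P[/eqP->] //.
- by move/eqP=> ->; rewrite adjE.
- move/eqP=> -> /and3P[zw wl _].
  by case: w zw wl => [|?|? ?|?||?|?||?] //; rewrite adjE.
Qed.

(** The two sides of the chain are followed by the paths towards spokes and towards
    leaves, and the edges at Apex are covered from a spoke to a leaf or to a
    side. *)
Lemma strong_upper : strong_edge_geodetic_set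
  (seg_pick Tail (Spoke : 'I_k.+1 -> core) @: setT).
Proof.
set S := _ @: _.
have inS i : seg_pick Tail Spoke i \in S by apply: imset_f.
have tS : (Tail : core) \in S := inS None.
have lS i : (Leaf i : core) \in S := inS (Some (inl (inl i))).
have sS i : (Side i : core) \in S := inS (Some (inl (inr i))).
have pS j : (Spoke j : core) \in S := inS (Some (inr j)).
have [chain chainP] := fin_all_exists chain_path.
pose P (u v : core) : option (seq core) :=
  match u, v with
  | Tail, Leaf i => Some (Tail :: chain false ++ [:: (Mid t0 : core); Hub; Leaf i])
  | Tail, Side i => Some (Tail :: chain true ++ [:: (Mid t0 : core); Side i])
  | Tail, Spoke j => Some (Tail :: chain true ++ [:: (Mid (mu j) : core); Spoke j])
  | Spoke j, Leaf i => Some [:: (Spoke j : core); Apex; Hub; Leaf i]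
  | Side i, Spoke j => Some [:: (Side i : core); Apex; Spoke j]
  | Side i, Leaf l => Some [:: (Side i : core); Hub; Leaf l]
  | _, _ => None
  end.
have climb_tail b (t : seq core) : path (up : rel core) top t ->
    shortest_path (Tail : core) (last top t) (Tail :: chain b ++ t).
  have [pp lp _ _] := chainP b; move=> tp.
  have := @climb_shortest core height height_lip Tail (chain b ++ t).
  by rewrite (eq_path climbE) cat_path pp lp tp last_cat lp => /(_ isT).
apply: (strong_of_partial_choice core_connected (P0 := P)).
  move=> u v s; case: u v => [|i|b i|t||i|j||i] [|i'|b' i'|t'||i'|j'||i'] //= [<-];
    split=> //.
  - by apply: (climb_tail true [:: (Mid t0 : core); Side i']);
      rewrite /= !eqxx.
  - by apply: (climb_tail true [:: (Mid (mu j') : core); Spoke j']);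
      rewrite /= !eqxx.
  - by apply: (climb_tail false [:: (Mid t0 : core); Hub; Leaf i']);
      rewrite /= !eqxx.
  - by apply: shortest2; rewrite // adjE.
  - by apply: shortest2; rewrite // adjE.
  - exact: spoke_to_leaf.
have short u v s (x y : core) : P u v = Some s -> u \in S -> v \in S -> u != v ->
    edge_on x y s -> exists u v s,
    [/\ u \in S, v \in S, u != v, P u v = Some s & edge_on x y s].
  by move=> *; exists u, v, s.
apply: core_adj_ind => [x y [u [v [s [uS vS nuv ss es]]]]|x y xy|i].
- by exists u, v, s; split=> //; rewrite edge_onC.
- case: x y xy => [|i|b i|t||i|j||i] [|i'|b' i'|t'||i'|j'||i'] //=.
  + move=> /eqP ei; apply: (short Tail (Leaf ord0) _ _ _ erefl) => //.
    have [_ _ e _] := chainP false; rewrite -cat_cons; apply: edge_on_cat.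
    by rewrite (_ : i' = ord0) //; apply: val_inj.
  + move=> /eqP ei; have [_ _ _ /(_ i')[e _]] := chainP b'.
    have -> : i = widen_ord (leqnSn n) i' by apply: val_inj.
    case: b' e => e.
      by apply: (short Tail (Spoke ord0) _ _ _ erefl) => //; rewrite -cat_cons; apply: edge_on_cat.
    by apply: (short Tail (Leaf ord0) _ _ _ erefl) => //; rewrite -cat_cons; apply: edge_on_cat.
  + move=> /eqP ei; have -> : i = ord_max by apply: val_inj.
    have joined b' (t : seq core) : edge_on top (Mid t') (Tail :: chain b' ++ (Mid t' : core) :: t).
      have [_ lp _ _] := chainP b'.
      by have := edge_on_join (G := core) Tail (Mid t') (chain b') t; rewrite lp.
    have [et|[j et]] := mu_onto t'.
      by apply: (short Tail (Leaf ord0) _ _ _ erefl) => //; rewrite -et; apply: joined.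
    by apply: (short Tail (Spoke j) _ _ _ erefl) => //; rewrite -et; apply: joined.
  + move=> /eqP ei; have [_ _ _ /(_ i)[_ e]] := chainP b.
    have -> : i' = lift ord0 i by apply: val_inj => /=; rewrite /bump /= ei.
    case: b e => e.
      by apply: (short Tail (Spoke ord0) _ _ _ erefl) => //; rewrite -cat_cons; apply: edge_on_cat.
    by apply: (short Tail (Leaf ord0) _ _ _ erefl) => //; rewrite -cat_cons; apply: edge_on_cat.
  + move=> /eqP->; apply: (short Tail (Leaf ord0) _ _ _ erefl) => //.
    by apply/edge_onP; exists (Tail :: chain false), [:: (Leaf ord0 : core)]; left.
  + move=> /eqP->; apply: (short Tail (Side i') _ _ _ erefl) => //.
    by apply/edge_onP; exists (Tail :: chain true), [::]; left.
  + move=> /eqP->; apply: (short Tail (Spoke j') _ _ _ erefl) => //.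
    by apply/edge_onP; exists (Tail :: chain true), [::]; left.
  + move=> _; exact: (short (Spoke ord0) (Leaf ord0) _ _ _ erefl).
  + move=> _; apply: (short Tail (Leaf i') _ _ _ erefl) => //.
    by apply/edge_onP; exists (Tail :: chain false ++ [:: (Mid t0 : core)]), [::]; left;
      rewrite /= -catA.
  + by move=> _; apply: (short (Side i) (Spoke ord0) _ _ _ erefl) => //;
      rewrite /edge_on /= ?inE ?eqxx ?orbT.
  + by move=> _; apply: (short (Spoke j) (Leaf ord0) _ _ _ erefl) => //;
      rewrite /edge_on /= ?inE ?eqxx ?orbT.
- by apply: (short (Side i) (Leaf ord0) _ _ _ erefl) => //;
      rewrite /edge_on /= ?inE ?eqxx ?orbT.
Qed.

Lemma below_hub_climbs_leaf (v : core) i :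
  below_hub v -> climbs v (Leaf i).
Proof. by move=> /below_hub_climbs/connect_trans; apply; apply: climbs1. Qed.

Lemma spoke_to_leaf_uniq j i s : mu j != t0 ->
  shortest_path (Spoke j : core) (Leaf i) s ->
  s = [:: (Spoke j : core); Apex; Hub; Leaf i].
Proof.
move=> nj /shortest_walkP[ws smin].
have := smin _ ((shortest_walkP _ _ _).1 (spoke_to_leaf j i)).1.
case: s ws {smin} => [//|z [|w [|x [|y [|? ?]]]]] //= /and3P[/eqP->] //.
- by move/eqP=> ->; rewrite adjE.
- move/eqP=> -> /and3P[zw wl _] _.
  by case: w zw wl => [|?|? ?|?||?|?||?] //; rewrite adjE.
- move/eqP=> -> /and4P[zw wx xl _] _.
  have ex : x = Hub by case: x xl {wx} => [|?|? ?|?||?|?||?] //; rewrite adjE.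
  rewrite ex in wx *; have [ew|->//] := adj_spoke zw.
  by move: wx; rewrite ew adjE /= orbF (negPf nj).
Qed.

(** An ascending edge is monitored by an ascending pair whose geodesics cannot avoid
    it ([climb_below], [climb_above]).  The edges at Apex, which has several
    lower neighbours, need a pair of distance at most three: with Apex itself when
    the middle vertices are merged, and otherwise with the ends on either side of
    Apex, where the detour through the last joint is too long. *)
Lemma meg_upper (S : {set core}) :
  (Tail : core) \in S -> (forall i, (Leaf i : core) \in S) ->
  (forall i, (Side i : core) \in S) -> (forall j, (Spoke j : core) \in S) ->
  (forall b i, (Twin b i : core) \in S) ->
  (mu =1 (fun=> t0) -> (Apex : core) \in S) -> meg_set S.
Proof.
move=> tS lS sS pS wS aS.
pose mon (u v x y : core) := forall s, shortest_path u v s -> edge_on x y s.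
have intro (u v x y : core) : u \in S -> v \in S -> u != v -> mon u v x y ->
  exists u v, [/\ u \in S, v \in S, u != v & mon u v x y].
  by move=> *; exists u, v.
have below (v x y : core) s : shortest_path (Tail : core) v s -> y \in s -> up x y ->
    (forall z : core, up z y -> z = x) -> edge_on x y s /\ x \in s.
  move=> ss ys xy uniq; apply: (climb_below height_lip (tail_climbs v) ss) => //.
    by move=> z; rewrite climbE; apply: uniq.
  by apply: contraTneq xy => ->; case: (x).
have lastin (u v : core) s : shortest_path u v s -> v \in s.
  by case; case: s => [//|z p] /and4P[_ /eqP<- _ _] _; rewrite mem_last.
have leaf_low i (z : core) : up z (Leaf i) -> z = Hub := @up_to_leaf z i.
have hub_low (z : core) : up z Hub -> z = Mid t0.
  by case: z => //= t /eqP->.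
have mid_low t (z : core) : up z (Mid t) -> z = top.
  by case: z => //= i /eqP e; congr Joint; apply: val_inj.
have spoke_low j (z : core) : up z (Spoke j) -> z = Mid (mu j).
  by case: z => //= t /eqP->.
have side_low i (z : core) : up z (Side i) -> z = Mid t0.
  by case: z => //= t /eqP->.
have twin_low b i (z : core) : up z (Twin b i) -> z = Joint (widen_ord (leqnSn n) i).
  by case: z => //= i' /eqP e; congr Joint; apply: val_inj.
have twin_up b (i : 'I_n) : up (Joint (widen_ord (leqnSn n) i)) (Twin b i) by exact: eqxx.
have mid_up t : up top (Mid t) by exact: eqxx.
have leaf_up i : up Hub (Leaf i) by [].
have hub_up : up (Mid t0) Hub by exact: eqxx.
have side_up i : up (Mid t0) (Side i) by exact: eqxx.
have spoke_up j : up (Mid (mu j)) (Spoke j) by exact: eqxx.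
have tail_leaf s : shortest_path (Tail : core) (Leaf ord0) s ->
    [/\ edge_on (Mid t0 : core) Hub s & edge_on top (Mid t0) s].
  move=> ss; have [_ hs] := below _ Hub _ _ ss (lastin _ _ _ ss) (leaf_up _) (leaf_low ord0).
  have [e ms] := below _ (Mid t0 : core) Hub _ ss hs hub_up hub_low.
  by have [] := below _ top (Mid t0) _ ss ms (mid_up _) (mid_low t0).
apply: core_adj_ind => [x y [u [v [uS vS nuv ss]]]|x y xy|i].
- by exists u, v; split=> // s /ss; rewrite edge_onC.
- case: x y xy => [|i|b i|t||i|j||i] [|i'|b' i'|t'||i'|j'||i'] //= xy.
  + apply: (intro Tail (Leaf ord0) _ _ tS (lS _) isT) => s ss.
    apply: (climb_above height_lip (tail_climbs (Leaf ord0)) ss) => // z.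
    rewrite climbE; case: z => //= i; rewrite -(eqP xy) => /eqP e.
    by congr Joint; apply: val_inj.
  + apply: (intro Tail (Twin b' i') _ _ tS (wS _ _) isT) => s ss.
    rewrite (twin_low b' i' (Joint i) xy).
    by have [] := below _ _ _ _ ss (lastin _ _ _ ss) (twin_up b' i') (twin_low b' i').
  + rewrite (mid_low t' (Joint i) xy); have [->|[j ->]] := mu_onto t'.
      by apply: (intro Tail (Leaf ord0) _ _ tS (lS _) isT) => s /tail_leaf[].
    apply: (intro Tail (Spoke j) _ _ tS (pS _) isT) => s ss.
    have [_ ms] := below _ _ _ _ ss (lastin _ _ _ ss) (spoke_up _) (spoke_low j).
    by have [] := below _ top _ _ ss ms (mid_up _) (mid_low _).
  + apply: (intro (Twin b i) (Leaf ord0) _ _ (wS _ _) (lS _) isT) => s ss.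
    apply: (climb_above height_lip (below_hub_climbs_leaf ord0 _) ss) => // z.
    rewrite climbE; case: z => //= j; rewrite -(eqP xy) => /eqP e.
    by congr Joint; apply: val_inj.
  + by rewrite (eqP xy); apply: (intro Tail (Leaf ord0) _ _ tS (lS _) isT) => s /tail_leaf[].
  + rewrite (eqP xy); apply: (intro Tail (Side i') _ _ tS (sS _) isT) => s ss.
    by have [] := below _ _ _ _ ss (lastin _ _ _ ss) (side_up _) (side_low i').
  + rewrite (eqP xy); apply: (intro Tail (Spoke j') _ _ tS (pS _) isT) => s ss.
    by have [] := below _ _ _ _ ss (lastin _ _ _ ss) (spoke_up _) (spoke_low j').
  + case: mu_split => [/aS AS|[_ nmu]].
      apply: (intro (Leaf ord0) Apex _ _ (lS _) AS isT) => s ss.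
      by apply: (proj2 (shortest2_edges (x := Hub : core) _ _ _ _ _ ss));
        rewrite // ?adjE // => y; rewrite adjE; case: y.
    apply: (intro (Spoke ord0) (Leaf ord0) _ _ (pS _) (lS _) isT) => s /spoke_to_leaf_uniq -> //.
  + apply: (intro Tail (Leaf i') _ _ tS (lS _) isT) => s ss.
    by have [] := below _ _ _ _ ss (lastin _ _ _ ss) (leaf_up _) (leaf_low i').
  + case: mu_split => [/aS AS|[_ nmu]].
      by apply: (intro (Side i) Apex _ _ (sS _) AS isT) => s; apply: shortest1_edge; rewrite adjE.
    apply: (intro (Side i) (Spoke ord0) _ _ (sS _) (pS _) isT) => s ss.
    apply: (proj1 (shortest2_edges (x := Apex : core) _ _ _ _ _ ss));
      rewrite // ?adjE // => y iy.
    rewrite adj_sym => /adj_spoke[ey|//].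
    by move: iy; rewrite ey adjE /= orbF (negPf (nmu _)).
  + case: mu_split => [/aS AS|[_ nmu]].
      by apply: (intro (Spoke j) Apex _ _ (pS _) AS isT) => s; apply: shortest1_edge; rewrite adjE.
    apply: (intro (Spoke j) (Leaf ord0) _ _ (pS _) (lS _) isT) => s.
    by move=> /spoke_to_leaf_uniq -> //; rewrite /edge_on /= inE eqxx.
- apply: (intro (Leaf ord0) (Side i) _ _ (lS _) (sS _) isT) => s ss.
  by apply: (proj2 (shortest2_edges (x := Hub : core) _ _ _ _ _ ss));
    rewrite // ?adjE // => y; rewrite adjE; case: y.
Qed.

(** * The four numbers *)

Lemma geodetic_core : geodetic_number core q.+3.
Proof.
have := min_card_le geodetic_upper (fun S => @geodetic_lower S).
by rewrite !card_option card_ord.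
Qed.

Lemma edge_geodetic_core : edge_geodetic_number core (q.+3 + m).
Proof.
have := min_card_le edge_geodetic_upper (fun S => @edge_geodetic_lower S).
by rewrite !card_option card_sum !card_ord.
Qed.

Lemma strong_edge_geodetic_core : strong_edge_geodetic_number core (q.+3 + m + k).
Proof.
have := min_card_le strong_upper (fun S => @strong_lower S).
by rewrite !card_option !card_sum !card_ord (_ : _.+1 = q.+3 + m + k) //; lia.
Qed.

Lemma meg_core : (forall j, mu j != t0) -> meg_number core (q.+3 + m + k + n.*2).
Proof.
move=> nmu.
have nmu0 : mu =1 (fun=> t0) -> False.
  by move/(_ ord0)/eqP; rewrite (negPf (nmu _)).
pose h := meg_pick (Spoke : 'I_k.+1 -> core).
have inS i : h i \in h @: setT by apply: imset_f.
have up_S : meg_set (h @: setT).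
  apply: meg_upper => [|i|i|j|b i|/nmu0[]].
  - exact: (inS None).
  - exact: (inS (Some (inl (inl (inl i))))).
  - exact: (inS (Some (inl (inl (inr i))))).
  - exact: (inS (Some (inl (inr j)))).
  - exact: (inS (Some (inr (b, i)))).
have := min_card_le up_S (fun S => @meg_lower S).
rewrite !card_option !card_sum card_prod card_bool !card_ord.
by rewrite (_ : _.+1 = q.+3 + m + k + n.*2) //; lia.
Qed.

Lemma meg_core_merged : mu =1 (fun=> t0) ->
  meg_number core (q.+3 + m + k + n.*2.+1).
Proof.
move=> mu0; pose h := meg_pick_apex (Spoke : 'I_k.+1 -> core).
have inS i : h i \in h @: setT by apply: imset_f.
have up_S : meg_set (h @: setT).
  apply: meg_upper => [|i|i|j|b i|_].
  - exact: (inS (Some None)).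
  - exact: (inS (Some (Some (inl (inl (inl i)))))).
  - exact: (inS (Some (Some (inl (inl (inr i)))))).
  - exact: (inS (Some (Some (inl (inr j))))).
  - exact: (inS (Some (Some (inr (b, i))))).
  - exact: (inS None).
have := min_card_le up_S (fun S => @meg_lower_merged S mu0).
rewrite !card_option !card_sum card_prod card_bool !card_ord.
by rewrite (_ : _.+1 = q.+3 + m + k + n.*2.+1) //; lia.
Qed.

End Construction.

Theorem theorem13 (a b c d : nat) (ha : 3 <= a) (hab : a <= b) (hbc : b <= c)
    (hcd : c <= d) :
  exists G : sgraph,
    [/\ connected_graph G, geodetic_number G a, edge_geodetic_number G b,
        strong_edge_geodetic_number G c & meg_number G d].
Proof.
pose q := a - 3; pose m := b - a; pose k := c - b; pose n := (d - c)./2.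
have ea : a = q.+3 by rewrite /q; lia.
have eb : b = q.+3 + m by rewrite /q /m; lia.
have ec : c = q.+3 + m + k by rewrite /q /m /k; lia.
have [odd_cd|even_cd] := boolP (odd (d - c)).
  have ed : d = q.+3 + m + k + n.*2.+1 by rewrite /q /m /k /n; lia.
  rewrite ed ec eb ea; clearbody q m k n.
  (* An odd difference d - c: all middle vertices merged. *)
  pose mu (j : 'I_k.+1) := tt.
  have mu_onto t : t = tt \/ exists j, t = mu j by case: t; left.
  have mu0 : mu =1 (fun=> tt) by [].
  exists (core n m q tt mu); split.
  - exact: core_connected.
  - by apply: geodetic_core; auto.
  - by apply: edge_geodetic_core; auto.
  - by apply: strong_edge_geodetic_core; auto.
  - by apply: meg_core_merged; auto.
have ed : d = q.+3 + m + k + n.*2 by rewrite /q /m /k /n; lia.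
rewrite ed ec eb ea; clearbody q m k n.
(* An even difference: a middle vertex of its own for each spoke, and None for Hub. *)
pose mu (j : 'I_k.+1) := Some j.
have mu_onto t : t = None \/ exists j, t = mu j.
  by case: t => [j|]; [right; exists j | left].
have mu_new j : mu j != None by [].
have mu_split : mu =1 (fun=> None) \/ injective mu /\ forall j, mu j != None.
  by right; split=> // i j [].
exists (core n m q None mu); split.
- exact: core_connected.
- exact: geodetic_core.
- exact: edge_geodetic_core.
- exact: strong_edge_geodetic_core.
- exact: meg_core.
Qed.
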